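(* Let $G$ be a countable group, let $A$ be a finite set, and let $X \subset A^G$ be a $G$-subshift. Let $M$ be a finitely generated sub-semigroup of $\mathrm{End}(X,G)$ that is pointwise periodic, i.e. for every $x \in X$ the orbit $\{f(x) : f \in M\}$ is finite. Then $M$ is finite.
   Context: $A^G$ carries the product topology ($A$ discrete), and $G$ acts on $A^G$ by the shift $\sigma^g(x)_h = x_{g^{-1}h}$ for $g,h \in G$. A $G$-subshift is a closed subset $X \subset A^G$ with $\sigma^g(X) \subset X$ for all $g \in G$. $\mathrm{End}(X,G)$ is the monoid (under composition) of all continuous maps $f : X \to X$ with $f \circ \sigma^g = \sigma^g \circ f$ for all $g \in G$. A sub-semigroup is a subset closed under composition; finitely generated means generated as a semigroup by a finite set. *)

(* Defs.v *)
From mathcomp Require Import all_boot.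
From mathcomp Require Import all_classical topology.

Set Implicit Arguments.
Unset Strict Implicit.
Unset Printing Implicit Defensive.

Local Open Scope classical_set_scope.
Local Open Scope group_scope.

Notation fullshift G A := {ptws G -> discrete_topology A}.

Definition shift (G : groupType) (A : finType) (g : G) (x : fullshift G A) :
    fullshift G A :=
  fun h => x (g^-1 * h).

Record subshift (G : groupType) (A : finType) := Subshift {
  subshift_set :> set (fullshift G A);
  subshift_closed : closed subshift_set;
  subshift_shift : forall g : G, shift g @` subshift_set `<=` subshift_set
}.

Lemma shift_mem (G : groupType) (A : finType) (X : subshift G A) (g : G)
  (x : X) : shift g (val x) \in (X : set _).
Proof.
by apply/mem_set/(@subshift_shift _ _ X g); exists (val x) => //; exact: set_valP.
Qed.

Definition shift_on (G : groupType) (A : finType) (X : subshift G A) (g : G)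
    (x : X) : X :=
  exist _ (shift g (val x)) (shift_mem g x).
Arguments shift_on {G A} X g x.

(* Continuity is with respect to the subspace topology that [set_type] puts on
   the type of points of X. *)
Definition Endo (G : groupType) (A : finType) (X : subshift G A) :
    set (X -> X) :=
  [set f | continuous f /\
           forall g : G, f \o shift_on X g = shift_on X g \o f].
Arguments Endo {G A} X _.

Definition comp_closed (T : Type) (M : set (T -> T)) :=
  forall f g, M f -> M g -> M (f \o g).

Definition subsemigroup_of (T : Type) (E M : set (T -> T)) :=
  M `<=` E /\ comp_closed M.

Definition finitely_generated (T : Type) (M : set (T -> T)) :=
  exists2 S : set (T -> T), finite_set S & M = smallest (@comp_closed T) S.

Definition pointwise_periodic (T : Type) (M : set (T -> T)) :=
  forall x : T, finite_set [set f x | f in M].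

(* Main.v *)
Require Import Defs.
From mathcomp Require Import all_boot.
From mathcomp Require Import all_classical topology.

(** Let [s] be a finite generating family of [M], indexed by [I]; words in
    letters of [I] act on [X].  For each [n], call a law of order [n] a pair of
    words [u], [v] that act alike on all points whose orbit has at most [n]
    elements, and let [Z n] be the closed set of points satisfying all laws of
    order [n].  These sets increase, are stable under [s] and the shifts, and
    cover [X] since every orbit is finite.  The laws of order [n] form a
    congruence of finite index on words, because an orbit with at most [n]
    points is an automaton with at most [n] states; hence finitely many of them
    imply the others, so membership in [Z n] is decided by looking through one
    clopen window at all the shifts of a point ([lawful_window]): relative to
    [X], the set [Z n] is of finite type.

    If for some [n] every word of length [n] maps [X] into [Z n], then [M] is
    finite, since the rest of a longer word can be replaced by one of finitely
    many representatives ([bounded_words]).  Finding such an [n] is a problem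
    about the single map [path_step] on pairs of a point and an infinite word,
    which applies the first letter to the point and drops it from the word.  So
    everything rests on [uniform_absorption]: if increasing [f]-stable sets [Z n]
    of relatively finite type cover a compact space, then [iter n f] maps the
    whole space into [Z n] for some [n].

    For this, suppose the contrary.  Being of finite type makes the failure pass
    to intersections of chains of closed invariant sets, so there is a minimal
    closed invariant set [E] on which it occurs.  If [C] is clopen and meets [E],
    then no [Z n] contains all points of [E] in [C]: the points of [E] whose
    orbit avoids the translates of [C] form a smaller invariant set, on which
    absorption is uniform, while the other points reach a translate of [C],
    hence would reach [Z n], in a time which compactness bounds
    ([maximal_evading_thin]).  So the relatively open sets [E] minus [Z n] are
    dense in [E], and as in the Baire category theorem nested clopen sets yield
    a point outside every [Z n]. *)

Set Implicit Arguments.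
Unset Strict Implicit.
Unset Printing Implicit Defensive.

Local Open Scope classical_set_scope.
Local Open Scope group_scope.

(** * Uniform absorption on compact spaces *)

Lemma compact_directed_cover (Y : topologicalType) (I : Type) (i0 : I)
    (U : I -> set Y) :
  compact [set: Y] -> (forall i, open (U i)) ->
  (forall i j, exists k, U i `|` U j `<=` U k) ->
  (forall y, exists i, U i y) -> exists i, forall y, U i y.
Proof.
move=> cptY openU dirU coverU; apply: contrapT => /forallNP noU.
pose F := filter_from [set: I] (fun i => ~` U i).
have FF : ProperFilter F.
  apply: filter_from_proper => [|i _]; last first.
    by have /existsNP[y nUy] := noU i; exists y.
  apply: filter_from_filter; first by exists i0.
  move=> i j _ _; have [k Uk] := dirU i j; exists k => // y nUk.
  by split=> Uy; apply: nUk; apply: Uk; [left | right].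
have [y [_ clFy]] := cptY F FF filterT.
have [i Uiy] := coverU y.
have [z [nUz Uz]] : ~` U i `&` U i !=set0.
  by apply: clFy; [exists i | apply: open_nbhs_nbhs].
exact: nUz.
Qed.

Section UniformAbsorption.
Variables (Y : topologicalType) (G : groupType).
Variables (T : G -> Y -> Y) (f : Y -> Y) (Z : nat -> set Y).
Hypothesis cptY : compact [set: Y].
Hypothesis contT : forall g, continuous (T g).
Hypothesis contf : continuous f.
Hypothesis T1 : forall y, T 1 y = y.
Hypothesis TM : forall g h y, T (g * h) y = T g (T h y).
Hypothesis fT : forall g y, f (T g y) = T g (f y).
Hypothesis Z_window : forall n,
  exists2 B, clopen B & forall y, Z n y <-> forall g, B (T g y).
Hypothesis Z_stable : forall n y, Z n y -> Z n (f y).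
Hypothesis Z_mono : forall m n y, m <= n -> Z m y -> Z n y.

Lemma iter_continuous n : continuous (iter n f).
Proof.
elim: n => [|n IHn] y; first exact: cvg_id.
by rewrite /=; apply: continuous_comp; [exact: IHn | exact: contf].
Qed.

Lemma iterT n g y : iter n f (T g y) = T g (iter n f y).
Proof. by elim: n => //= n ->; rewrite fT. Qed.

Lemma Z_iter m n k y : m <= n -> Z k (iter m f y) -> Z k (iter n f y).
Proof.
by move=> /subnK <-; elim: (n - m)%N => //= d IHd /IHd /Z_stable.
Qed.

Lemma Z_shift n g y : Z n (T g y) <-> Z n y.
Proof.
have [B _ ZB] := Z_window n; rewrite !ZB; split=> By h.
  by rewrite -[h](divgK g) TM.
by rewrite -TM.
Qed.

(** Complements of the closed invariant sets on which absorption is not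
    uniform.  Working with complements turns a minimal closed set into a maximal
    open one, the form in which Zorn's lemma is stated for sets.  A single [n]
    serves both as time and as index of [Z], as both can be increased. *)
Definition evading (O : set Y) :=
  [/\ open O, forall g y, O y -> O (T g y), forall y, O (f y) -> O y
    & forall n, exists2 y, ~ O y & ~ Z n (iter n f y)].

(** If absorption were uniform off the union, with constant [n], then the window
    of [Z n] read at time [n] would define an open set that, with the union,
    covers the space, hence already with one member of the chain.  Invariance
    then carries the window to all translates and contradicts this member. *)
Lemma evading_chain (F : set (set Y)) :
  (forall n, exists y, ~ Z n (iter n f y)) ->
  F `<=` evading -> total_on F subset -> evading (\bigcup_(O in F) O).
Proof.
move=> notZ evF totF.
have [-> | /set0P[O0 FO0]] := eqVneq F set0.
  rewrite bigcup_set0; split=> // [|n]; first exact: open0.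
  by have [y Zy] := notZ n; exists y.
split=> [|g y [O FO Oy]|y [O FO Oy]|n].
- by apply: bigcup_open => O /evF[].
- by exists O => //; have [_ + _ _] := evF _ FO; apply.
- by exists O => //; have [_ _ + _] := evF _ FO; apply.
have [B [openB _] ZB] := Z_window n.
pose U (O : {O | F O}) := sval O `|` iter n f @^-1` B.
apply: contrapT => /forall2NP noy.
have [//||||[O FO] /= coverO] := @compact_directed_cover Y _ (exist _ O0 FO0) U.
- move=> [O FO]; apply: openU; first by have [] := evF _ FO.
  by apply: open_comp => // y _; exact: iter_continuous.
- move=> [O FO] [P FP]; rewrite /U /=.
  have [OP | PO] := totF _ _ FO FP.
    by exists (exist _ P FP) => y /= [[/OP Py|]|]; [by left | by right | by []].
  by exists (exist _ O FO) => y /= [|[/PO Oy|]]; [by [] | by left | by right].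
- move=> y; have [/contrapT[O FO Oy]|/contrapT] := noy y.
    by exists (exist _ O FO); left.
  by move=> /ZB /(_ 1); rewrite T1 => By; exists (exist _ O0 FO0); right.
have [_ OT _ /(_ n)[y nOy]] := evF _ FO; apply.
apply/ZB => g; rewrite -iterT.
have [/= Oy|//] := coverO (T g y).
by case: nOy; rewrite -[y]T1 -(mulVg g) TM; apply: OT.
Qed.

(** Otherwise [C] minus [O] lies in [Z n].  Enlarge [O] by all points whose orbit
    meets a translate of [C]: by maximality, absorption is uniform, with some
    constant [k], off this enlargement.  By compactness every point is in [O],
    or shows the window of [Z k] at time [k], or meets a translate of [C] by a
    fixed time [l]; in the last case it has entered [Z n], which is invariant
    under translation.  Thus absorption is uniform off [O] itself. *)
Lemma maximal_evading_thin (O C : set Y) n :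
  evading O -> (forall P, O `<` P -> ~ evading P) ->
  clopen C -> C `&` ~` O !=set0 -> exists2 y, C y /\ ~ O y & ~ Z n y.
Proof.
move=> [openO OT Of evO] maxO [openC closedC] [y0 [Cy0 nOy0]].
apply: contrapT => CZ.
have {}CZ y : C y -> ~ O y -> Z n y.
  by move=> Cy nOy; apply: contrapT => nZy; apply: CZ; exists y.
pose P l := O `|` \bigcup_(j in [set j | j <= l])
  \bigcup_g ((iter j f) @^-1` (T g @^-1` C)).
have openP l : open (P l).
  apply: openU => //; apply: bigcup_open => j _; apply: bigcup_open => g _.
  apply: open_comp => [y _|]; first exact: iter_continuous.
  by apply: open_comp => [y _|//]; exact: contT.
have nevP : ~ evading (\bigcup_l P l).
  apply: maxO; split=> [y Oy|]; first by exists 0 => //; left.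
  move=> /(_ y0) PO; apply: nOy0; apply: PO; exists 0 => //; right.
  by exists 0 => //; exists 1 => //=; rewrite T1.
have [k kP] : exists k, forall y, ~ (\bigcup_l P l) y -> Z k (iter k f y).
  apply: contrapT => /forallNP nk; apply: nevP; split.
  - by apply: bigcup_open => l _.
  - move=> g y [l _ [Oy|[j jl [h _ /= Cy]]]]; exists l => //.
      by left; apply: OT.
    right; exists j => //; exists (h * g^-1) => //=.
    by rewrite iterT -TM divgK.
  - move=> y [l _ [Oy|[j jl [h _ /= Cy]]]]; first by exists l => //; left; exact: Of.
    exists l.+1 => //; right; exists j.+1 => //; exists h => //=.
    by rewrite -iterS iterSr.
  - by move=> m; have /existsNP[y /not_implyP[]] := nk m; exists y.
have [B [openB _] ZB] := Z_window k.
have [//||||l coverP] :=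
    @compact_directed_cover Y _ 0 (fun l => P l `|` iter k f @^-1` B).
- move=> l; apply: openU => //.
  by apply: open_comp => // y _; exact: iter_continuous.
- move=> l m; exists (maxn l m) => y.
  have PS a b : a <= b -> P a `<=` P b.
    move=> ab z [Oz|[j ja Hz]]; first by left.
    by right; exists j => //; exact: leq_trans ab.
  case=> [[Py|By]|[Py|By]]; try by right.
    by left; apply: PS Py; exact: leq_maxl.
  by left; apply: PS Py; exact: leq_maxr.
- move=> y; have [[l _ Py]|/kP] := pselect ((\bigcup_l P l) y).
    by exists l; left.
  by move=> /ZB /(_ 1); rewrite T1 => By; exists 0; right.
pose N := maxn n (maxn k l).
have [y nOy] := evO N; apply.
have OTy g : ~ O (T g y).
  by move=> Oy; apply: nOy; rewrite -[y]T1 -(mulVg g) TM; apply: OT.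
have Oiter j z : ~ O z -> ~ O (iter j f z).
  by move=> nOz; elim: j => //= j IHj /Of.
(* Translating [y] does not change whether its orbit enters [Z n] by time [l],
   so if it does not, all translates of [y] show the window of [Z k]. *)
have [[j [jl Zj]]|noj] := pselect (exists j, j <= l /\ Z n (iter j f y)).
  apply: (Z_mono (m := n)); first exact: leq_maxl.
  by apply: Z_iter Zj; rewrite (leq_trans jl) // /N !leq_max leqnn !orbT.
apply: (Z_mono (m := k)); first by rewrite /N !leq_max leqnn !orbT.
apply: (Z_iter (m := k)); first by rewrite /N !leq_max leqnn !orbT.
apply/ZB => g; rewrite -iterT.
have [[/(OTy g)//|[j jl [h _ /= Cy]]]|//] := coverP (T g y).
case: noj; exists j; split=> //.
rewrite iterT in Cy; apply/(Z_shift n g)/(Z_shift n h)/CZ => //.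
by rewrite -TM -iterT; apply: Oiter; exact: OTy.
Qed.

(** Given [O] maximal evading, each clopen set meeting the complement of [O] can
    be shrunk to one that still meets it but misses [Z n]; the intersection of
    the resulting sequence would be a point in no [Z n]. *)
Theorem uniform_absorption :
  (forall y, exists n, Z n y) -> exists n, forall y, Z n (iter n f y).
Proof.
move=> coverZ; apply: contrapT => /forallNP notZ.
have [|O [evO maxO]] := @Zorn_bigcup Y evading.
  move=> F; apply: evading_chain => n; exact/existsNP/notZ.
pose meetsO (C : set Y) := clopen C /\ C `&` ~` O !=set0.
pose D := {C | meetsO C}.
have [next nextP] : exists next : nat -> D -> D, forall n C,
    sval (next n C) `<=` sval C `\` Z n.
  have H n (C : D) : exists C' : D, sval C' `<=` sval C `\` Z n.
    case: C => C [clC CO] /=.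
    have [y [Cy nOy] nZy] := maximal_evading_thin n evO (fun P h => maxO P h) clC CO.
    have [B clB ZB] := Z_window n.
    have /existsNP[g nB] : ~ forall g, B (T g y) by move=> /ZB.
    have HC' : meetsO (C `&` ~` (T g @^-1` B)).
      split; last by exists y.
      apply: clopenI => //; apply: clopenC; first exact: setT.
      by apply: preimage_clopen => //; exact: contT.
    exists (exist meetsO _ HC') => z /= [Cz nBz]; split=> // Zz.
    by apply: nBz; exact: (ZB z).1 Zz g.
  have [h hP] := @choice (nat * D)%type D
    (fun p C' => sval C' `<=` sval p.2 `\` Z p.1) (fun p => H p.1 p.2).
  by exists (fun n C => h (n, C)) => n C; exact: (hP (n, C)).
have [_ _ _ evO'] := evO; have [y0 nOy0 _] := evO' 0.
have C0 : D by exists setT; split; [exact: clopenT | exists y0].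
pose C := fix C n := if n is m.+1 then next m (C m) else C0.
have Cle m n : m <= n -> sval (C n) `<=` sval (C m).
  move=> /subnK <-; elim: (n - m)%N => //= d IHd y Hy.
  by apply: IHd; have [] := nextP _ _ _ Hy.
have [//||||n nC] := @compact_directed_cover Y _ 0 (fun n => ~` sval (C n)).
- by move=> n; apply: closed_openC; have [[]] := svalP (C n).
- move=> m n; exists (maxn m n) => y.
  by case=> nCy Cy; apply: nCy; apply: Cle Cy; [exact: leq_maxl | exact: leq_maxr].
- move=> y; have [n Zny] := coverZ y; exists n.+1 => /= Cy.
  by have [] := nextP _ _ _ Cy.
by have [_ [y [Cy _]]] := svalP (C n); exact: nC Cy.
Qed.

End UniformAbsorption.

(** * Words acting on points with finite orbits *)

Section Words.
Variables (X : eqType) (I : finType) (s : I -> X -> X).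

Definition act (w : seq I) (x : X) : X := foldr s x w.

Lemma act_cat u v x : act (u ++ v) x = act u (act v x).
Proof. exact: foldr_cat. Qed.

Definition orbit_le n x := exists2 l : seq X, size l <= n & forall w, act w x \in l.

Definition orbit_law n u v := forall x, orbit_le n x -> act u x = act v x.

Definition lawful n x := forall u v, orbit_law n u v -> act u x = act v x.

Lemma orbit_le_act n w x : orbit_le n x -> orbit_le n (act w x).
Proof. by case=> l ln lP; exists l => // v; rewrite -act_cat. Qed.

Lemma orbit_le_lawful n x : orbit_le n x -> lawful n x.
Proof. by move=> nx u v; apply. Qed.

Lemma lawful_act n w x : lawful n x -> lawful n (act w x).
Proof.
move=> nx u v uv; rewrite -!act_cat; apply: nx => y ny.
by rewrite !act_cat; apply: uv; apply: orbit_le_act.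
Qed.

Lemma lawful_mono m n x : m <= n -> lawful m x -> lawful n x.
Proof.
move=> mn mx u v uv; apply: mx => y [l lm lP].
by apply: uv; exists l => //; exact: leq_trans mn.
Qed.

(** Number the points of an orbit by [n.+1] states: the action of the letters
    becomes a transition table [t] with a start state [i], and a word is read as
    a final state.  Words with the same final state for all tables and start
    states satisfy a law, and there are finitely many such behaviours. *)
Lemma orbit_law_finite_index n :
  exists L : seq (seq I), forall u, exists2 r, r \in L & orbit_law n u r.
Proof.
pose run (t : {ffun I * 'I_n.+1 -> 'I_n.+1}) i w := foldr (fun a j => t (a, j)) i w.
pose phi w := [ffun p => run p.1 p.2 w].
have phiP u v : phi u = phi v -> orbit_law n u v.
  move=> uv x [l ln lP].
  have ltn_index y : index y l < n.+1.
    by rewrite ltnS (leq_trans _ ln) // index_size.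
  pose i : 'I_n.+1 := inord (index x l).
  pose t := [ffun p : I * 'I_n.+1 =>
    inord (index (s p.1 (nth x l p.2)) l) : 'I_n.+1].
  have runP w : nth x l (run t i w) = act w x.
    elim: w => [|a w IHw] /=; first by rewrite inordK // nth_index //; exact: (lP [::]).
    by rewrite ffunE inordK //= IHw nth_index //; exact: (lP (a :: w)).
  by move/ffunP/(_ (t, i)): uv; rewrite !ffunE /= -!runP => ->.
pose rep q := xget [::] [set w | phi w = q].
exists [seq rep q | q <- enum [set: _]%SET] => u.
exists (rep (phi u)); first by apply: map_f; rewrite mem_enum inE.
by apply: phiP; apply/esym; exact: (@xgetPex _ [::] [set w | phi w = phi u] (ex_intro _ u erefl)).
Qed.

(** Finitely many laws imply all of order [n]: with [L] a list of
    representatives, the laws between words that are empty, in [L], or a letter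
    followed by a word in [L], suffice to rewrite any word, letter by letter,
    into a representative. *)
Lemma lawful_of_test_words n L x :
  (forall u, exists2 r, r \in L & orbit_law n u r) ->
  (forall u v, u \in [::] :: L ++ [seq a :: r | a <- enum I, r <- L] ->
     v \in [::] :: L ++ [seq a :: r | a <- enum I, r <- L] ->
     orbit_law n u v -> act u x = act v x) ->
  lawful n x.
Proof.
move=> Lrep; set L' := _ :: _ => testx.
have LL' r : r \in L -> r \in L' by move=> rL; rewrite inE mem_cat rL orbT.
have norm u : exists2 r, r \in L & orbit_law n u r /\ act u x = act r x.
  elim: u => [|a u [r rL [ur uxr]]].
    have [r rL nr] := Lrep [::]; exists r => //; split=> //.
    by apply: testx => //; exact: LL'.
  have [r' r'L arr'] := Lrep (a :: r); exists r' => //; split.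
    by move=> y ny; rewrite -arr' //= ur.
  rewrite /= uxr; apply: (testx (a :: r)) arr'; last exact: LL'.
  by rewrite inE mem_cat allpairs_f ?orbT // mem_enum.
move=> u v uv; have [q qL [uq ->]] := norm u; have [r rL [vr ->]] := norm v.
by apply: testx; [exact: LL' | exact: LL' | move=> y ny; rewrite -uq // uv // vr].
Qed.

(** Only the last [k] letters of a word need to be kept: on their image, the
    letters before them may be replaced by a representative. *)
Lemma bounded_words n k :
  (forall w, size w = k -> forall x, lawful n (act w x)) ->
  exists N, forall w, exists2 v, size v <= N & act v = act w.
Proof.
move=> kn; have [L Lrep] := orbit_law_finite_index n.
exists (k + \max_(r <- L) size r)%N => w.
have [wk | kw] := ltnP (size w) k.
  by exists w => //; rewrite (leq_trans (ltnW wk)) // leq_addr.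
pose u := take (size w - k) w; pose v := drop (size w - k) w.
have vk : size v = k by rewrite size_drop subKn.
have [r rL ur] := Lrep u; exists (r ++ v).
  by rewrite size_cat vk addnC leq_add2l (@leq_bigmax_seq _ _ _ size).
apply: funext => x; rewrite -(cat_take_drop (size w - k) w) !act_cat.
by apply/esym/kn.
Qed.

End Words.

Lemma finite_set_bounded_seq (I : finType) N : finite_set [set w : seq I | size w <= N].
Proof.
suff -> : [set w : seq I | size w <= N] =
    \bigcup_(k in [set k | k <= N]) range (@tval k I).
  apply: bigcup_finite => [|k _]; first exact: (finite_II N.+1).
  exact/finite_image/finite_finset.
apply/seteqP; split=> [w wN | w [k kN [t _ <-]]] /=.
  by exists (size w) => //; exists (in_tuple w).
by rewrite size_tuple.
Qed.

(** * Lawfulness is a relatively finite type condition *)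

Section Windows.
Variable X : topologicalType.

Lemma continuous_discrete_near (D : choiceType)
    (h : X -> discrete_topology D) x :
  continuous h -> nbhs x [set y | h y = h x].
Proof.
move=> /(_ x) /(_ [set h x]); apply.
by rewrite nbhs_principalE; apply/principal_filterP.
Qed.

Lemma clopen_eq (A : finType) (k k' : X -> discrete_topology A) :
  continuous k -> continuous k' -> clopen [set x | k x = k' x].
Proof.
move=> ck ck'; split; last rewrite -openC; rewrite openE => x kx;
  apply: filterS (filterI (continuous_discrete_near x ck)
    (continuous_discrete_near x ck')) => y [/= kyx k'yx].
  by rewrite kyx k'yx.
by rewrite kyx k'yx.
Qed.

Lemma clopen_all_seq (K : eqType) (L : seq K) (P : K -> set X) :
  (forall k, clopen (P k)) -> clopen [set x | forall k, k \in L -> P k x].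
Proof.
move=> cP; elim: L => [|k L IHL].
  by rewrite (_ : mkset _ = setT); [exact: clopenT | apply/seteqP; split].
rewrite (_ : mkset _ = P k `&` [set x | forall k, k \in L -> P k x]); first exact: clopenI.
apply/seteqP; split=> x /=; last first.
  by move=> [Pk PL] j; rewrite inE => /predU1P[->|/PL].
move=> kL; split=> [|j jL]; first by apply: kL; rewrite inE eqxx.
by apply: kL; rewrite inE jL orbT.
Qed.

Variables (I : finType) (s : I -> X -> X).
Hypothesis conts : forall i, continuous (s i).
Variables (G : groupType) (T : G -> X -> X).
Hypothesis sT : forall i g x, s i (T g x) = T g (s i x).
Variables (A : finType) (e : X -> discrete_topology A).
Hypothesis conte : continuous e.
Hypothesis e_expansive : forall x y, (forall g, e (T g x) = e (T g y)) -> x = y.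

Lemma act_continuous w : continuous (act s w).
Proof.
elim: w => [|i w IHw] x; first exact: cvg_id.
by rewrite /=; apply: continuous_comp; [exact: IHw | exact: conts].
Qed.

Lemma actT w g x : act s w (T g x) = T g (act s w x).
Proof. by elim: w => //= i w ->; rewrite sT. Qed.

(** The laws between test words are tested at a single symbol; shifting by all
    [g] recovers them at all symbols. *)
Lemma lawful_window n :
  exists2 B, clopen B & forall x, lawful s n x <-> forall g, B (T g x).
Proof.
have [L Lrep] := orbit_law_finite_index s n.
pose L' := [::] :: L ++ [seq a :: r | a <- enum I, r <- L].
exists [set x | forall u, u \in L' -> forall v, v \in L' ->
  orbit_law s n u v -> e (act s u x) = e (act s v x)].
  apply: (@clopen_all_seq _ L' (fun u => [set x | forall v, v \in L' ->
    orbit_law s n u v -> e (act s u x) = e (act s v x)])) => u.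
  apply: (@clopen_all_seq _ L' (fun v => [set x |
    orbit_law s n u v -> e (act s u x) = e (act s v x)])) => v.
  have [uv | nuv] := pselect (orbit_law s n u v); last first.
    rewrite (_ : mkset _ = setT); first exact: clopenT.
    by apply/seteqP; split=> x // _ /nuv.
  rewrite (_ : mkset _ = [set x | e (act s u x) = e (act s v x)]).
    have ce w : continuous (fun x => e (act s w x)).
      by move=> x; apply: continuous_comp; [exact: act_continuous | exact: conte].
    exact: clopen_eq.
  by apply/seteqP; split=> x /= xuv; [exact: xuv | move=> _].
move=> x; split=> [nx g u _ v _ uv | Bx].
  by rewrite !actT (nx u v uv).
apply: (lawful_of_test_words Lrep) => u v uL vL uv; apply: e_expansive => g.
by rewrite -!actT; apply: Bx.
Qed.

End Windows.

(** * The path system *)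

Lemma pair_continuous (U V W : topologicalType) (f : U -> V) (g : U -> W) :
  continuous f -> continuous g -> continuous (fun x => (f x, g x)).
Proof. by move=> cf cg x; exact: cvg_pair (cf x) (cg x). Qed.

Section PathSystem.
Variables (X : topologicalType) (I : finType) (s : I -> X -> X).
Local Notation path := {ptws nat -> discrete_topology I}.

(** Following one infinite word at a time makes a single map out of the family
    [s].  This matters when paths are required to avoid a set: the points having
    one path that avoids it need not form a set stable under all of [s]. *)
Definition path_step (p : X * path) : X * path :=
  (s (p.2 0) p.1, fun m => p.2 m.+1).

(** Words act with their last letter first, whence the reversal. *)
Lemma iter_path_step w x (o : path) :
  (forall d m, m < size w -> o m = nth d (rev w) m) ->
  (iter (size w) path_step (x, o)).1 = act s w x.
Proof.
elim/last_ind: w x o => //= w a IHw x o ow.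
rewrite size_rcons iterSr /path_step /= /act foldr_rcons -/(act s w _).
rewrite (ow a) ?size_rcons // rev_rcons /=.
apply: IHw => d m mw.
by rewrite (ow d) ?size_rcons // rev_rcons.
Qed.

Lemma ptws_continuous (U : topologicalType) (J : eqType) (V : topologicalType)
    (k : U -> {ptws J -> V}) :
  (forall j, continuous (fun u => k u j)) -> continuous k.
Proof.
move=> ck u; apply/cvg_sup => j B [_ [[W oW <-] Wu] WB].
by apply: filterS WB _; apply: (ck j u); apply: open_nbhs_nbhs.
Qed.

Lemma path_step_continuous :
  (forall i, continuous (s i)) -> continuous path_step.
Proof.
move=> conts.
have co j : continuous (fun p : X * path => p.2 j).
  move=> p; apply: (@continuous_comp _ _ _ snd (fun o : path => o j)).
    exact: cvg_snd.
  exact: (@proj_continuous _ (fun=> discrete_topology I)).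
apply: pair_continuous => [[x o]|]; last first.
  apply: (@ptws_continuous _ nat (discrete_topology I)
    (fun p : X * path => fun m => p.2 m.+1)) => j.
  exact: co.
have near0 : \forall p \near (x, o), p.2 0 = o 0.
  exact: (continuous_discrete_near (x, o) (co 0)).
apply: (@cvg_trans _ ((fun p : X * path => s (o 0) p.1) @ (x, o))).
  by apply: near_eq_cvg; apply: filterS near0 => p ->.
apply: (@continuous_comp _ _ _ fst (s (o 0))); first exact: cvg_fst.
exact: conts.
Qed.

Lemma ptws_compact (J : eqType) : compact [set: {ptws J -> discrete_topology I}].
Proof.
rewrite (_ : setT = [set k | forall j : J, [set: discrete_topology I] (k j)]).
  apply: (@tychonoff J (fun=> discrete_topology I) (fun=> setT)) => _.
  by apply: finite_compact; exact: (@finite_finset I).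
by apply/seteqP; split.
Qed.

Variables (G : groupType) (T : G -> X -> X) (A : finType).
Variable e : X -> discrete_topology A.
Hypothesis cptX : compact [set: X].
Hypothesis conts : forall i, continuous (s i).
Hypothesis contT : forall g, continuous (T g).
Hypothesis T1 : forall x, T 1 x = x.
Hypothesis TM : forall g h x, T (g * h) x = T g (T h x).
Hypothesis sT : forall i g x, s i (T g x) = T g (s i x).
Hypothesis conte : continuous e.
Hypothesis e_expansive : forall x y, (forall g, e (T g x) = e (T g y)) -> x = y.

(** Uniform absorption of the path system says that all words of one length map
    [X] into one set of lawful points. *)
Theorem bounded_words_of_finite_orbits :
  (forall x, exists n, orbit_le s n x) ->
  exists N, forall w, exists2 v, size v <= N & act s v = act s w.
Proof.
move=> finX.
pose TY g (p : X * path) := (T g p.1, p.2).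
pose Z n (p : X * path) := lawful s n p.1.
have [||||||||||n nP] := @uniform_absorption _ G TY path_step Z.
- by rewrite -setXTT; apply: compact_setX => //; exact: ptws_compact.
- move=> g; apply: pair_continuous => p; last exact: cvg_snd.
  apply: (@continuous_comp _ _ _ fst (T g)); first exact: cvg_fst.
  exact: contT.
- exact: path_step_continuous.
- by case=> x o; rewrite /TY T1.
- by move=> g h [x o]; rewrite /TY TM.
- by move=> g [x o]; rewrite /TY /path_step /= sT.
- move=> n; have [B clB BP] := lawful_window conts sT conte e_expansive n.
  exists (fst @^-1` B); last by move=> p; exact: BP.
  by apply: preimage_clopen => // p; exact: cvg_fst.
- by move=> n [x o] /(lawful_act [:: o 0]).
- by move=> m n [x o]; exact: lawful_mono.
- by case=> x o; have [n /orbit_le_lawful] := finX x; exists n.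
(* The first letter [a] serves as the default value of [nth], which words of
   length [n] alone would not provide for [n = 0]. *)
apply: (@bounded_words _ _ s n n.+1) => [[|a w]] // [wn] x.
rewrite -cat1s act_cat; apply: lawful_act.
rewrite -(@iter_path_step w x (nth a (rev w))); first by rewrite wn; exact: nP.
by move=> d m mw; apply: set_nth_default; rewrite size_rev.
Qed.

End PathSystem.

(** * Subshifts *)

Lemma set_type_compact (Y : topologicalType) (K : set Y) :
  compact K -> compact [set: K].
Proof.
move=> cptK F FF _.
have FK : F (set_val @^-1` K) by apply: filterE => x; exact: set_valP.
have [y [Ky clFy]] := cptK _ (fmap_proper_filter _ FF) FK.
exists (exist _ y (mem_set Ky)); split=> // B N FB [_ [[W oW <-] Wy] WN].
have [] := clFy (set_val @` B) W.
- by apply: (@filterS _ F _ B) => // x Bx; exists x.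
- exact: open_nbhs_nbhs.
by move=> _ [[x Bx <-] Wx]; exists x; split=> //; exact: WN.
Qed.

Section Subshift.
Variables (G : groupType) (A : finType) (X : subshift G A).

Lemma subshift_compact : compact [set: X].
Proof.
apply: set_type_compact.
exact: (subclosed_compact (@subshift_closed _ _ X) (@ptws_compact A G) (@subsetT _ _)).
Qed.

Lemma symbol_continuous g : continuous (fun x : X => val x g : discrete_topology A).
Proof.
move=> x; apply: (@continuous_comp _ _ _ (val : X -> fullshift G A) (fun y => y g)).
  exact: initial_continuous.
exact: (@proj_continuous G (fun=> discrete_topology A)).
Qed.

Lemma shift_on_continuous g : continuous (shift_on X g).
Proof.
apply/continuousP => _ [W oW <-].
have /continuousP/(_ _ oW) : continuous (fun x => val (shift_on X g x)).
  by apply: ptws_continuous => h; exact: symbol_continuous.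
by [].
Qed.

Lemma shift_on1 x : shift_on X 1 x = x.
Proof. by apply/val_inj/funext => h; rewrite /= /shift invg1 mul1g. Qed.

Lemma shift_onM g h x : shift_on X (g * h) x = shift_on X g (shift_on X h x).
Proof. by apply/val_inj/funext => k; rewrite /= /shift invgM mulgA. Qed.

Lemma shift_expansive (x y : X) :
  (forall g, val (shift_on X g x) 1 = val (shift_on X g y) 1) -> x = y.
Proof.
move=> xy; apply/val_inj/funext => g.
by have := xy g^-1; rewrite /= /shift invgK mulg1.
Qed.

End Subshift.

Unset Implicit Arguments.

Theorem theorem1p6 (G : groupType) (A : finType) (X : subshift G A)
    (M : set (X -> X)) :
  countable [set: G] ->
  subsemigroup_of (Endo X) M ->
  finitely_generated M ->
  pointwise_periodic M ->
  finite_set M.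
Proof.
move=> _ [ME Mcomp] [S finS MS] Mper.
have /(@finite_seqP {classic (X -> X)})[l Sl] := finS.
(* The extra index [size l] gives the identity, so that every list [l], even an
   empty one, yields a family of maps on a type ['I_n.+1]. *)
pose s (i : 'I_(size l).+1) : X -> X := nth id (l : seq (X -> X)) i.
have SM : S `<=` M by rewrite MS => f Sf N [_]; apply.
have sM i : M (s i) \/ s i = id.
  have [il | li] := ltnP i (size l); last by right; exact: nth_default.
  by left; apply: SM; rewrite Sl; exact: (@mem_nth {classic (X -> X)}).
have actM w : M (act s w) \/ act s w = id.
  elim: w => [|i w IHw]; first by right.
  rewrite (_ : act s (i :: w) = s i \o act s w) //.
  have [Mi | ->] := sM i; have [Mw | ->] := IHw; [left | left | left | right] => //.
  exact: Mcomp.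
have Mact : M `<=` range (act s).
  rewrite MS; apply: smallest_sub.
    by move=> _ _ [u _ <-] [v _ <-]; exists (u ++ v) => //; apply: funext => x; rewrite act_cat.
  rewrite Sl => f /= fl; have fl' : index (f : {classic (X -> X)}) l < (size l).+1.
    by rewrite ltnS index_size.
  by exists [:: Ordinal fl'] => //; apply: funext => x; rewrite /= /s /= (@nth_index {classic (X -> X)}).
have sE i : continuous (s i) /\ forall g, s i \o shift_on X g = shift_on X g \o s i.
  have [/ME // | ->] := sM i; split=> // x; exact: cvg_id.
have [|||||||||N NP] := @bounded_words_of_finite_orbits X _ s G (shift_on X) A (fun x : X => val x 1).
- exact: subshift_compact.
- by move=> i; have [] := sE i.
- exact: shift_on_continuous.
- exact: shift_on1.
- exact: shift_onM.
- by move=> i g x; have [_ /(_ g)/(congr1 (@^~ x))] := sE i.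
- exact: symbol_continuous.
- exact: shift_expansive.
- move=> x; have /finite_seqP[o oP] := Mper x.
  exists (size (x :: o)), (x :: o) => // w; rewrite inE.
  have [Mw | ->] := actM w; last by rewrite eqxx.
  suff : [set` o] (act s w x) by move=> /= ->; rewrite orbT.
  by rewrite -oP; exists (act s w).
apply: (@sub_finite_set _ _ (act s @` [set w | size w <= N])).
  by move=> f /Mact[w _ <-]; have [v vN <-] := NP w; exists v.
exact/finite_image/finite_set_bounded_seq.
Qed.
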